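(* Let $n,a,b,r$ be positive integers with $n\ge a+b$, and let $\mathcal A\subset\binom{[n]}{a}$, $\mathcal B\subset\binom{[n]}{b}$ be cross-intersecting. Suppose one of the following holds: (i) $a<b$ and $|\mathcal A|\ge r$; (ii) $a=b$ and $|\mathcal A|,|\mathcal B|\ge r$; (iii) $a>b$, $|\mathcal A|\ge r$ and $|\mathcal B|\ge\binom{n}{b}-\binom{n-a+b}{b}+r$. Then for $1\le r\le b-1$, $$|\mathcal A|+|\mathcal B|\le\binom{n}{b}-\binom{n-a+1}{b}+\binom{n-a-r+1}{b-r}+r,$$ and for $b\le r\le n-a+1$, $$|\mathcal A|+|\mathcal B|\le\binom{n}{b}-\binom{n-a+1}{b}+n-a+1.$$
   Context: $\mathcal A,\mathcal B$ are cross-intersecting if $A\cap B\ne\emptyset$ for all $A\in\mathcal A$, $B\in\mathcal B$. *)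

(* Defs.v *)
From mathcomp Require Import all_boot.
Set Implicit Arguments. Unset Strict Implicit. Unset Printing Implicit Defensive.

Definition cross_intersecting (n : nat) (A B : {set {set 'I_n}}) : Prop :=
  forall X Y, X \in A -> Y \in B -> X :&: Y != set0.

Definition uniform (n k : nat) (F : {set {set 'I_n}}) : Prop :=
  forall X, X \in F -> #|X| = k.

(* Main.v *)
(** Hilton's form of the Kruskal-Katona theorem: exchanging U for V
    (disjoint, of equal size, min (U :|: V) in U) in both families
    simultaneously, smallest admissible exchanges first, keeps them
    cross-intersecting, so both may be assumed closed under lexicographic
    predecessors.  Let x be the least point.  In such a pair one family has only
    sets through x, and passing to the sets through x of that family and the
    sets missing x of the other gives a pair on one point fewer.  With
    c = n - a, the bound reads C(n,b) - T(c,b,r), where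
    T(c,b,r) = C(c+1,b) - C(c+1-r,b-r) - r.  If x lies in all of A, then (a,b,c)
    becomes (a-1,b,c) and T is unchanged.  If x lies in all of B and a < b, then
    (a,b,c,r) becomes (a,b-1,c-1,max(r-K,0)) with K = C(n-1,a-1), and the claim
    follows from the convexity of binomial coefficients in the upper index.
    The case r >= b is implied by r = b-1, where the two bounds agree. *)

Require Import Defs.
From mathcomp Require Import all_boot zify.
Set Implicit Arguments. Unset Strict Implicit. Unset Printing Implicit Defensive.

(** * Compression to lexicographically closed families *)

Section Compression.
Variable n : nat.
Implicit Types (U V W X Y Z : {set 'I_n}) (F A B : {set {set 'I_n}}).

(** Strict lexicographic order: the least element of the symmetric difference lies in [W]. *)
Definition prec W Z :=
  [exists x in W :\: Z, [forall y in Z :\: W, x < y]].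

Lemma precP W Z :
  reflect (exists2 x, x \in W :\: Z & forall y, y \in Z :\: W -> x < y)
          (prec W Z).
Proof.
apply: (iffP exists_inP) => [[x xW /forall_inP xZ]|[x xW xZ]]; exists x => //.
exact/forall_inP.
Qed.

Lemma prec_irr W : prec W W = false.
Proof. by apply/precP=> -[x]; rewrite setDv inE. Qed.

Lemma prec_trans : transitive prec.
Proof.
move=> Y X Z /precP[x] /setDP[xX xY] ltx /precP[y] /setDP[yY yZ] lty.
have ltYX z : z \in Y -> z \notin X -> x < z.
  by move=> zY zX; apply: ltx; rewrite inE zX.
have ltZY z : z \in Z -> z \notin Y -> y < z.
  by move=> zZ zY; apply: lty; rewrite inE zY.
apply/precP; case: (ltngtP x y) => [xy|yx|/val_inj xy]; last 1 first.
- by rewrite -xy (negPf xY) in yY.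
- exists x => [|z /setDP[zZ zX]].
    rewrite inE xX andbT; apply/negP=> xZ.
    by have := ltZY _ xZ xY; rewrite ltnNge ltnW.
  by have [/ltYX->//|/(ltZY _ zZ)] := boolP (z \in Y); apply: ltn_trans.
- exists y => [|z /setDP[zZ zX]].
    rewrite inE yZ /=; apply/negPn/negP=> yX.
    by have := ltYX _ yY yX; rewrite ltnNge ltnW.
  have [zY|/(ltZY _ zZ)//] := boolP (z \in Y).
  by apply: ltn_trans yx _; apply: ltYX.
Qed.

Definition lex_rank X := #|[set Z | prec Z X]|.

Lemma ltn_lex_rank W X : prec W X -> lex_rank W < lex_rank X.
Proof.
move=> WX; apply: proper_card; apply/properP; split.
  by apply/subsetP=> Z; rewrite !inE => /prec_trans; apply.
by exists W; rewrite !inE ?prec_irr.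
Qed.

(** The partial closure available when every exchange of fewer than [d] elements is already
    exhausted. *)
Definition lex_closed_upto d F := forall Z W,
  Z \in F -> #|W| = #|Z| -> prec W Z -> #|W :\: Z| < d -> W \in F.

Definition exch U V X := X :\: V :|: U.

Lemma in_exch U V X i :
  (i \in exch U V X) = (i \notin V) && (i \in X) || (i \in U).
Proof. by rewrite !inE. Qed.

Lemma card_exch U V X : #|U| = #|V| -> V \subset X -> [disjoint U & X] ->
  #|exch U V X| = #|X|.
Proof.
move=> cUV VX dUX; rewrite cardsU cardsD (setIidPr VX).
rewrite (_ : _ :&: U = set0) ?cards0 ?subn0 ?cUV ?subnK ?subset_leq_card //.
apply/setP=> i; rewrite !inE; apply/negP=> /andP[/andP[_ iX] iU].
by have := disjointFr dUX iU; rewrite iX.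
Qed.

Lemma prec_exch U V X u : u \in U -> (forall v, v \in V -> u < v) ->
  [disjoint U & X] -> prec (exch U V X) X.
Proof.
move=> uU uV UX; apply/precP; exists u => [|y /setDP[yX]].
  by rewrite inE in_exch uU (disjointFr UX uU) orbT.
by rewrite in_exch yX andbT negb_or negbK => /andP[/uV].
Qed.

(** * Simultaneous exchange of [U] for [V] *)

Section UV.
Variables U V : {set 'I_n}.

(** The last conjunct keeps a set in place when its image is already in [F]; this makes [move]
    injective on [F]. *)
Definition movable F X :=
  [&& V \subset X, [disjoint U & X] & exch U V X \notin F].
Definition move F X := if movable F X then exch U V X else X.
Definition compress F := [set move F X | X in F].

Hypothesis cardUV : #|U| = #|V|.
Hypothesis dUV : [disjoint U & V].

Lemma exchK X : V \subset X -> [disjoint U & X] -> exch U V X :\: U :|: V = X.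
Proof.
move=> /subsetP VX dUX; apply/setP=> i; rewrite !inE.
have [iU|iU] /= := boolP (i \in U).
  by rewrite (disjointFr dUX iU) (disjointFr dUV iU).
by rewrite orbF; have [/VX->|] := boolP (i \in V); rewrite ?orbT ?orbF.
Qed.

Lemma move_inj F : {in F &, injective (move F)}.
Proof.
move=> X Y XF YF; rewrite /move.
case mX: (movable F X); case mY: (movable F Y) => // e.
- move/and3P: mX => [VX UX _]; move/and3P: mY => [VY UY _].
  by rewrite -(exchK VX UX) e exchK.
- by move/and3P: mX => [_ _]; rewrite e YF.
- by move/and3P: mY => [_ _]; rewrite -e XF.
Qed.

Lemma card_compress F : #|compress F| = #|F|.
Proof. exact/card_in_imset/move_inj. Qed.

Lemma uniform_compress k F : uniform k F -> uniform k (compress F).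
Proof.
move=> uF _ /imsetP[X XF ->]; rewrite /move.
by case: ifP => [/and3P[VX UX _]|_]; rewrite ?card_exch //; apply: uF.
Qed.

Variable u0 : 'I_n.
Hypotheses (u0U : u0 \in U) (u0V : forall v, v \in V -> u0 < v).

Definition rank_sum F := \sum_(X in F) lex_rank X.

Lemma leq_rank_move F X : lex_rank (move F X) <= lex_rank X.
Proof.
rewrite /move; case: ifP => // /and3P[_ UX _].
exact/ltnW/ltn_lex_rank/(prec_exch u0U).
Qed.

Lemma leq_rank_compress F : rank_sum (compress F) <= rank_sum F.
Proof.
rewrite /rank_sum big_imset /=; last exact: move_inj.
by apply: leq_sum => X _; apply: leq_rank_move.
Qed.

Lemma ltn_rank_compress F X :
  X \in F -> movable F X -> rank_sum (compress F) < rank_sum F.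
Proof.
move=> XF mX; rewrite /rank_sum big_imset /=; last exact: move_inj.
rewrite (bigD1 X) //= [X in _ < X](bigD1 X) //= -addSn leq_add //.
  rewrite /move mX; move/and3P: mX => [_ UX _].
  exact/ltn_lex_rank/(prec_exch u0U).
by apply: leq_sum => Y _; apply: leq_rank_move.
Qed.

(** If the exchanged [X] missed [Y], then exchanging [Y] too, undoing the exchange of [X], or
    shrinking it by one element would give disjoint members of [A] and [B]. *)
Lemma exch_meets A B X Y : cross_intersecting A B ->
  lex_closed_upto #|U| A -> X \in A -> movable A X ->
  Y \in B -> ~~ movable B Y -> exch U V X :&: Y != set0.
Proof.
move=> xAB cA XA /and3P[VX UX _] YB nY; apply/negP=> /eqP e0.
have eY i : i \in exch U V X -> i \notin Y.
  move=> iX; apply/negP=> iY; move/setP/(_ i): e0.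
  by rewrite !inE -in_exch iX iY.
have meet X' Y' : X' \in A -> Y' \in B ->
    (forall i, i \in X' -> i \notin Y') -> False.
  move=> X'A Y'B d; have /set0Pn[i] := xAB _ _ X'A Y'B.
  by rewrite inE => /andP[/d/negP].
have UY : [disjoint U & Y].
  rewrite disjoint_subset; apply/subsetP=> i iU; apply: eY.
  by rewrite in_exch iU orbT.
(* If [Y] contains [V], it failed to move only because its image is already in [B]; that image
   misses [X]. *)
have [VY|/subsetPn[v vV vY]] := boolP (V \subset Y).
  apply: (meet X (exch U V Y)) => //.
    by move: nY; rewrite /movable VY UY /= negbK.
  move=> i iX; rewrite in_exch negb_or negb_and negbK.
  rewrite (disjointFl UX iX) andbT.
  by have [|iV] //= := boolP (i \in V); rewrite eY // in_exch iV iX.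
(* In a one-element exchange [X] loses only [v], which is outside [Y], so [X] itself misses [Y]. *)
have [U1|/subsetPn[u uU]] := boolP (U \subset [set u0]).
  have V1 : V = [set v].
    apply/eqP; rewrite eq_sym eqEcard sub1set vV cards1 -cardUV.
    by rewrite -(cards1 u0) subset_leq_card.
  apply: (meet X Y) => // i iX; have [->//|iv] := eqVneq i v.
  by apply: eY; rewrite in_exch V1 inE iv iX.
rewrite inE => uu0.
(* Since [u != u0], the smaller pair [(U - u, V - v)] is still admissible, so
   its exchange maps [X] to a member of [A], and that member misses [Y]. *)
pose U' := U :\ u; pose V' := V :\ v.
have cU' : #|U'| = #|V'|.
  by move: cardUV; rewrite (cardsD1 u U) (cardsD1 v V) uU vV => -[].
apply: (meet (exch U' V' X) Y) => //; last first.
  move=> i; rewrite in_exch !inE negb_and negbK.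
  have [->|iv] /= := eqVneq i v; first by [].
  move=> h; apply: eY; rewrite in_exch.
  by case/orP: h => [->//|/andP[_ ->]]; rewrite orbT.
have dU'X : [disjoint U' & X] by apply: disjointWl UX; apply: subD1set.
apply: (cA X) => //.
- by apply: card_exch => //; apply: subset_trans VX; apply: subD1set.
- apply: (@prec_exch _ _ _ u0) => //; first by rewrite !inE eq_sym uu0.
  by move=> y /setD1P[_ /u0V].
- apply: (@leq_ltn_trans #|U'|); last by rewrite (cardsD1 u U) uU.
  apply/subset_leq_card/subsetP=> i; rewrite inE in_exch => /andP[iX].
  by rewrite (negPf iX) andbF.
Qed.

Lemma cross_compress A B : cross_intersecting A B ->
  lex_closed_upto #|U| A -> lex_closed_upto #|U| B ->
  cross_intersecting (compress A) (compress B).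
Proof.
move=> xAB cA cB _ _ /imsetP[X XA ->] /imsetP[Y YB ->].
rewrite /move; case mX: (movable A X); case mY: (movable B Y).
- by apply/set0Pn; exists u0; rewrite inE !in_exch u0U !orbT.
- by apply: (exch_meets xAB) => //; rewrite mY.
- rewrite setIC; apply: (@exch_meets B A) => //; last by rewrite mX.
  by move=> ? ? ? ?; rewrite setIC xAB.
- exact: xAB.
Qed.
End UV.

(** * Reduction to lexicographically closed pairs *)

Definition lex_closed F := forall Z W,
  Z \in F -> #|W| = #|Z| -> prec W Z -> W \in F.

Definition lex_gap F (p : {set 'I_n} * {set 'I_n}) :=
  [&& p.1 \in F, p.2 \notin F, #|p.2| == #|p.1| & prec p.2 p.1].

Lemma gap_movable F Z W : lex_gap F (Z, W) -> movable (W :\: Z) (Z :\: W) F Z.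
Proof.
move=> /and4P[/= ZF WF _ _]; apply/and3P; split.
- exact: subsetDl.
- by rewrite disjoint_sym disjoints_subset setDE setCI setCK subsetUr.
- suff -> : exch (W :\: Z) (Z :\: W) Z = W by [].
  by apply/setP=> i; rewrite !inE; case: (i \in Z); case: (i \in W).
Qed.

(** Induction on the total lexicographic rank, which compressing both families at a gap strictly
    lowers. *)
Lemma lex_reduction a b A B :
  uniform a A -> uniform b B -> cross_intersecting A B ->
  exists A' B', [/\ uniform a A' /\ uniform b B', cross_intersecting A' B',
    #|A'| = #|A| /\ #|B'| = #|B|, lex_closed A' & lex_closed B'].
Proof.
have [m] := ubnP (rank_sum A + rank_sum B).
elim: m A B => // m IHm A B ltm uA uB xAB.
pose gap p := lex_gap A p || lex_gap B p.
have [/existsP[p0 gap0]|/existsPn nogap] := boolP [exists p, gap p]; last first.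
  by exists A, B; split=> // Z W ZF cWZ WZ; apply/negPn/negP=> WF;
    have /negP[] := nogap (Z, W);
    rewrite /gap /lex_gap /= ZF WF cWZ WZ eqxx ?orbT.
(* Minimality over the gaps of both families yields the partial closure that [cross_compress]
   requires of each. *)
have [[Z W] gapZW minZW] := @arg_minnP _ p0 gap (fun p => #|p.2 :\: p.1|) gap0.
pose U := W :\: Z; pose V := Z :\: W.
have [cWZ /precP[u uU uV]] : #|W| = #|Z| /\ prec W Z.
  by case/orP: gapZW => /and4P[_ _ /eqP ? ?].
have cUV : #|U| = #|V|.
  apply/eqP; rewrite -(eqn_add2l #|W :&: Z|) cardsID.
  by rewrite setIC cardsID cWZ.
have dUV : [disjoint U & V].
  rewrite disjoints_subset; apply/subsetP=> i; rewrite !inE.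
  by case: (i \in Z); rewrite ?andbF.
have closed F : (forall p, lex_gap F p -> gap p) -> lex_closed_upto #|U| F.
  move=> gF Z' W' Z'F c p; rewrite ltnNge; apply: contraR => W'F.
  by apply: (minZW (Z', W')); apply: gF; rewrite /lex_gap /= Z'F W'F c eqxx.
have cA : lex_closed_upto #|U| A by apply: closed => p gp; rewrite /gap gp.
have cB : lex_closed_upto #|U| B by apply: closed => p gp; rewrite /gap gp orbT.
have [||||A' [B' [uAB' xAB' [cA' cB'] lA' lB']]] :=
    IHm (compress U V A) (compress U V B).
- apply: leq_trans (_ : _ < rank_sum A + rank_sum B) ltm.
  have lA := leq_rank_compress dUV uU uV A.
  have lB := leq_rank_compress dUV uU uV B.
  case/orP: gapZW => g; have /and4P[/= ZF _ _ _] := g; have mZ := gap_movable g.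
    by rewrite -addSn leq_add // (ltn_rank_compress dUV uU uV ZF).
  by rewrite -addnS leq_add // (ltn_rank_compress dUV uU uV ZF).
- exact: uniform_compress.
- exact: uniform_compress.
- exact: (cross_compress cUV uU uV).
by exists A', B'; split; rewrite // cA' cB' !card_compress.
Qed.
End Compression.

(** * Binomial inequalities *)

(** Pascal's rule lowers [m] while [k + l < m]; at [k + l = m] symmetry gives equality. *)
Lemma leq_bin_unimodal m k l : k <= l -> k + l <= m -> 'C(m, k) <= 'C(m, l).
Proof.
elim: m k l => [|m IHm] [|k] [|l] //; first by rewrite !bin0 bin_gt0.
move=> kl klm; have [klm'|lem] := leqP (k + l.+1) m.-1.
  by rewrite !binS leq_add // IHm; lia.
have {lem} e : m.+1 - k.+1 = l.+1 by lia.
by rewrite -(@bin_sub m.+1 k.+1) ?e //; lia.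
Qed.

(** By Pascal's rule the increments in the upper index are binomials of lower index one less, hence
    nondecreasing. *)
Lemma bin_convex d x m s :
  'C(x + m, d) + 'C(x + s, d) <= 'C(x, d) + 'C(x + m + s, d).
Proof.
case: d => [|d]; first by rewrite !bin0.
elim: m => [|m IHm]; first by rewrite !addn0.
rewrite addnS addSn !binS addnAC [leqRHS]addnA leq_add //.
by rewrite leq_bin2l // leq_addr.
Qed.

(* Here and below ['C(c.+1 - r, c.+1 - b)] is ['C(c.+1 - r, b - r)], written so
   that [r] occurs in the upper index only. *)
Lemma bin_drop c b r r' : b <= c -> r <= r' -> r' <= b ->
  'C(c.+1 - r', c.+1 - b) + r' <= 'C(c.+1 - r, c.+1 - b) + r.
Proof.
move=> bc; elim: r' => [|r' IHr']; first by rewrite leqn0 => /eqP->.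
rewrite leq_eqVlt => /predU1P[->//|]; rewrite ltnS => rr' r'b.
apply: leq_trans (IHr' rr' (ltnW r'b)).
have r'c : r' <= c by lia.
rewrite subSS (subSn r'c) (subSn bc) binS addnS -addSn leq_add2r.
by rewrite -addn1 leq_add2l bin_gt0 leq_sub2l // ltnW.
Qed.

Lemma bin_split c b m s : 0 < m -> m + s < b -> b <= c ->
  'C(c.+1 - m, c.+1 - b) + 'C(c - s, c.+1 - b) <=
  'C(c.+1 - (m + s), c.+1 - b) + 'C(c, b.-1).
Proof.
move=> m0 msb bc; rewrite -(@bin_sub c b.-1); last lia.
have -> : c - b.-1 = c.+1 - b by lia.
have := bin_convex (c.+1 - b) (c.+1 - (m + s)) s m.-1.
have -> : c.+1 - (m + s) + s = c.+1 - m by lia.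
have -> : c.+1 - (m + s) + m.-1 = c - s by lia.
by have -> : c.+1 - m + m.-1 = c by lia.
Qed.

(** Equality at [a = 2]. Raising [a] by one adds ['C((a + c).-1, a)] on the left and
    ['C((a + c).-1, b.-1)] on the right, compared by unimodality. *)
Lemma bin_sum_bound a b c : 2 <= a -> a <= b -> b <= c ->
  'C((a + c).-1, a.-1) + 'C(c.+1, b) <= 'C((a + c).-1, b) + c.+1.
Proof.
case: a => [|[|a]] // _; elim: a b => [|a IHa] [|b] // ab bc /=.
  by rewrite bin1 addnC.
have /= := IHa b.+1 (ltnW ab) bc.
have := @leq_bin_unimodal (a + c).+1 a.+2 b ab.
rewrite !addSn /= !binS.
by lia.
Qed.

(* [K] counts the [a]-sets through the least point; the subtraction [r - K]
   is truncated. *)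
Lemma bin_step a b c r : 0 < a -> a < b -> b <= c -> r < b ->
  let K := 'C((a + c).-1, a.-1) in
  K + 'C(c.+1, b) + ('C(c - (r - K), c.+1 - b) + (r - K)) <=
  'C((a + c).-1, b) + 'C(c, b.-1) + ('C(c.+1 - r, c.+1 - b) + r).
Proof.
move=> a0 ab bc rb /=; set K := 'C(_, a.-1).
have K0 : 0 < K by rewrite bin_gt0; lia.
have eb : 'C(c, c.+1 - b) = 'C(c, b.-1).
  by rewrite -(@bin_sub c b.-1); [congr 'C(_, _); lia | lia].
have [a1|a2] : a = 1 \/ 2 <= a by lia.
  have eK : K = 1 by rewrite /K a1 bin0.
  rewrite eK a1 [1 + c]add1n succnK.
  have -> : 'C(c.+1, b) = 'C(c, b) + 'C(c, b.-1).
    by case: b ab {bc rb eb} => // b _; rewrite binS.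
  have [r0|r0] := posnP r; last first.
    have -> : c - (r - 1) = c.+1 - r; lia.
  have := @bin_drop c b 0 1 bc isT; rewrite r0 subSS !subn0; lia.
(* If [K <= r], convexity handles the splitting of [r] into [K] and [r - K]. Otherwise [r - K] is 0,
   and the worst case [r = b - 1], of value [c + 1], is covered by [bin_sum_bound]. *)
have [Kr|rK] := leqP K r.
  have := @bin_split c b K (r - K) K0; rewrite (subnKC Kr) => /(_ rb bc).
  have : 'C(c.+1, b) <= 'C((a + c).-1, b) by apply: leq_bin2l; lia.
  by lia.
have -> : r - K = 0 by lia.
have := bin_sum_bound a2 (ltnW ab) bc; rewrite -/K.
have := @bin_drop c b r b.-1 bc.
have -> : c.+1 - b.-1 = (c.+1 - b).+1 by lia.
by rewrite binSn subn0 eb; lia.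
Qed.

(** * Induction on the ground set *)

Section LexInduction.
Variable n : nat.
Implicit Types (S W X Y Z : {set 'I_n}) (F A B : {set {set 'I_n}}).

(** The ground set is a subset of a fixed ['I_n], so deleting a point does not change the type. *)
Definition lex_family S k F :=
  [/\ {in F, forall X, X \subset S}, uniform k F
    & forall Z W, Z \in F -> W \subset S -> #|W| = #|Z| -> prec W Z -> W \in F].

Lemma cross_sym A B : cross_intersecting A B -> cross_intersecting B A.
Proof. by move=> xAB X Y XB YA; rewrite setIC xAB. Qed.

Lemma leq_card_family S k F :
  {in F, forall X, X \subset S} -> uniform k F -> #|F| <= 'C(#|S|, k).
Proof.
move=> sF uF; rewrite -cards_draws subset_leq_card //.
by apply/subsetP=> X XF; rewrite inE sF // uF /=.
Qed.

Lemma subset_of_card S k : k <= #|S| ->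
  exists2 W : {set 'I_n}, W \subset S & #|W| = k.
Proof.
rewrite -bin_gt0 -cards_draws card_gt0 => /set0Pn[W].
by rewrite inE => /andP[WS /eqP cW]; exists W.
Qed.

(** * Splitting a family at a point *)

Variable x : 'I_n.

Definition link F : {set {set 'I_n}} :=
  [set Y : {set 'I_n} | (x \notin Y) && (x |: Y \in F)].
Definition deletion F : {set {set 'I_n}} := [set Y in F | x \notin Y].

Lemma card_link_deletion F : #|F| = #|link F| + #|deletion F|.
Proof.
rewrite -(cardsID [set Y : {set 'I_n} | x \in Y] F); congr (_ + _); last first.
  by apply: eq_card => Y; rewrite !inE andbC.
have -> : F :&: [set Y : {set 'I_n} | x \in Y] = [set x |: Y | Y in link F].
  apply/setP=> X; rewrite !inE; apply/andP/imsetP=> [[XF xX]|[Y]].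
    by exists (X :\ x); rewrite ?inE ?eqxx setD1K.
  by rewrite inE => /andP[_ xYF] ->; rewrite xYF setU11.
apply: card_in_imset => Y Z; rewrite !inE => /andP[xY _] /andP[xZ _] e.
by rewrite -(setU1K xY) e setU1K.
Qed.

Lemma cross_link_deletion A B :
  cross_intersecting A B -> cross_intersecting (link A) (deletion B).
Proof.
move=> xAB X Y; rewrite !inE => /andP[xX XA] /andP[YB xY].
have /set0Pn[i] := xAB _ _ XA YB; rewrite !inE => /andP[/predU1P[->|iX] iY].
  by rewrite (negPf xY) in iY.
by apply/set0Pn; exists i; rewrite inE iX.
Qed.

Variable S : {set 'I_n}.
Hypotheses (xS : x \in S) (xmin : forall y, y \in S -> x <= y).

Lemma prec_min X Y : x \in X -> x \notin Y -> Y \subset S -> prec X Y.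
Proof.
move=> xX xY /subsetP YS; apply/precP; exists x => [|y];
  rewrite !inE ?xX ?andbT //.
move=> /andP[_ yY]; rewrite ltn_neqAle xmin ?YS // andbT.
by apply: contraNneq xY => /val_inj->.
Qed.

Lemma lex_family_link k F :
  lex_family S k F -> lex_family (S :\ x) k.-1 (link F).
Proof.
move=> [sF uF lF]; split=> [X|X|Z W]; rewrite !inE.
- move=> /andP[xX /sF]; rewrite subUset => /andP[_ XS].
  by rewrite subsetD1 XS.
- by move=> /andP[xX /uF]; rewrite cardsU1 xX => <-.
move=> /andP[xZ ZF]; rewrite subsetD1 => /andP[WS xW] cWZ /precP[y yW yZ].
rewrite xW; apply: lF ZF _ _ _.
- by rewrite subUset sub1set xS.
- by rewrite !cardsU1 xW xZ cWZ.
apply/precP; exists y => [|z].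
  move: yW; rewrite !inE => /andP[yZ' yW]; rewrite yW orbT andbT.
  by rewrite (negPf yZ') orbF; apply: contraNneq xW => <-.
rewrite !inE negb_or => /andP[/andP[zx zW]]; rewrite (negPf zx) => zZ.
by apply: yZ; rewrite inE zW.
Qed.

Lemma lex_family_deletion k F :
  lex_family S k F -> lex_family (S :\ x) k (deletion F).
Proof.
move=> [sF uF lF]; split=> [X|X|Z W]; rewrite !inE.
- by move=> /andP[/sF XS xX]; rewrite subsetD1 XS.
- by move=> /andP[/uF].
move=> /andP[ZF xZ]; rewrite subsetD1 => /andP[WS xW] cWZ WZ.
by rewrite xW andbT; apply: lF ZF _ _ _.
Qed.

Lemma missed_link_set k X : x \notin X -> X \subset S -> #|X| + k < #|S| ->
  exists W, [/\ W \subset S :\ x, #|W| = k & X :&: (x |: W) = set0].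
Proof.
move=> xX XS lt; have [|W] := @subset_of_card (S :\: (x |: X)) k.
  rewrite cardsD (setIidPr _) ?subUset ?sub1set ?xS // cardsU1 xX.
  by lia.
move=> /subsetP WS cW; exists W; split=> //.
  apply/subsetP=> i /WS; rewrite !inE negb_or => /andP[/andP[-> _]].
  by [].
apply/setP=> i; rewrite !inE; apply/negP=> /andP[iX /predU1P[ix|/WS]].
  by rewrite -ix iX in xX.
by rewrite !inE iX orbT.
Qed.

(* If [X] in [A] misses [x], some [b]-set through [x] avoids [X], and lex order
   would put it in [B] as soon as [B] had a member missing [x]. *)
Lemma deletion_empty a b A B : lex_family S a A -> lex_family S b B ->
  cross_intersecting A B -> 0 < b -> a + b <= #|S| ->
  deletion A != set0 -> deletion B = set0.
Proof.
move=> [sA uA _] [sB uB lB] xAB b0 abS /set0Pn[X]; rewrite inE => /andP[XA xX].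
apply/eqP; apply/set0Pn=> -[Y]; rewrite inE => /andP[YB xY].
have [|W [WS cW XW]] := @missed_link_set b.-1 X xX (sA _ XA).
  by rewrite uA //; lia.
move: WS; rewrite subsetD1 => /andP[WS xW].
suff /(xAB X _ XA) : x |: W \in B by rewrite XW eqxx.
apply: (lB Y) => //; first by rewrite subUset sub1set xS.
  by rewrite cardsU1 xW cW (uB _ YB) add1n prednK.
by apply: prec_min; rewrite ?setU11 ?sB.
Qed.

(** A member of [A] missing [x] is disjoint from some [b]-set through [x], which therefore is not in
    [B]. *)
Lemma ltn_card_link a b A B : lex_family S a A -> lex_family S b B ->
  cross_intersecting A B -> 0 < b -> a + b <= #|S| ->
  deletion A != set0 -> #|link B| < 'C(#|S|.-1, b.-1).
Proof.
move=> [sA uA _] fB xAB b0 abS /set0Pn[X]; rewrite inE => /andP[XA xX].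
have [|W [WS cW XW]] := @missed_link_set b.-1 X xX (sA _ XA).
  by rewrite uA //; lia.
have [sB uB _] := lex_family_link fB.
have -> : #|S|.-1 = #|S :\ x| by rewrite (cardsD1 x S) xS.
rewrite -cards_draws; apply/proper_card/properP; split.
  by apply/subsetP=> Y YB; rewrite inE sB //= uB.
exists W; first by rewrite inE WS cW /=.
rewrite inE; apply/negP=> /andP[_ WB].
by have := xAB X (x |: W) XA WB; rewrite XW eqxx.
Qed.
End LexInduction.

(** * The bound for lexicographically closed pairs *)

Definition size_condition a b c r p q :=
  [\/ a < b /\ r <= p, a = b /\ r <= p /\ r <= q
    | b < a /\ r <= p /\ 'C(a + c, b) + r <= q + 'C(c + b, b)].

(** Induction on [#|S|] at its least point. The values [a = 0] and [r = 0] are allowed because the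
    induction reaches them. *)
Lemma lex_bound n (S : {set 'I_n}) a b c r (A B : {set {set 'I_n}}) :
  #|S| = a + c -> r < b -> b <= c ->
  lex_family S a A -> lex_family S b B -> cross_intersecting A B ->
  size_condition a b c r #|A| #|B| ->
  #|A| + #|B| + 'C(c.+1, b) <= 'C(a + c, b) + ('C(c.+1 - r, c.+1 - b) + r).
Proof.
have [m] := ubnP #|S|; elim: m S a b c r A B => // m IHm S a b c r A B.
move=> Sm cS rb bc fA fB xAB cond.
have x0 : exists x, x \in S by apply/set0Pn; rewrite -card_gt0; lia.
have [x xS xmin] :
    exists2 x : 'I_n, x \in S & forall y : 'I_n, y \in S -> x <= y.
  by case: x0 => x0 x0S; case: (arg_minnP (@nat_of_ord n) x0S) => x; exists x.
have cS' : #|S :\ x|.+1 = #|S| by rewrite (cardsD1 x S) xS.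
have [sA uA _] := fA; have [sB uB _] := fB.
have [a0|a0] := posnP a.
  have cA : #|A| <= 1 by rewrite -(bin0 #|S|) leq_card_family // -a0.
  have cB : 0 < #|A| -> #|B| = 0.
    rewrite card_gt0 => /set0Pn[X XA]; apply: eq_card0 => Y; apply/negP=> YB.
    have := xAB X Y XA YB; have := uA _ XA; rewrite a0 => /eqP.
    by rewrite cards_eq0 => /eqP->; rewrite set0I eqxx.
  have := leq_card_family sB uB; rewrite cS a0 add0n => cB'.
  have [b0 rA] : 0 < b /\ r <= #|A| by case: cond => [[]|[]|[]]; lia.
  have := bin_drop bc (leq_trans rA cA) b0; rewrite subSS subn0.
  have := @bin_sub c b.-1; have := @bin_sub c.+1 b.
  have -> : c - b.-1 = c.+1 - b by lia.
  have -> : 'C(c.+1, b) = 'C(c, b) + 'C(c, b.-1).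
    by case: b b0 {cB' fB uB cond rb bc} => // b _; rewrite binS.
  have [A0|/cB] := posnP #|A|; last by lia.
  have -> : r = 0 by lia.
  by rewrite subn0; lia.
have Sxm : #|S :\ x| < m by lia.
have cSx : #|S :\ x| = a.-1 + c by lia.
(* The case where [x] lies in all of the first family, stated for any pair so that it also serves
   with the roles swapped when [a = b]. *)
have step (A' B' : {set {set 'I_n}}) :
    lex_family S a A' -> lex_family S b B' -> cross_intersecting A' B' ->
    deletion x A' = set0 -> size_condition a b c r #|A'| #|B'| ->
    #|A'| + #|B'| + 'C(c.+1, b) <= 'C(a + c, b) + ('C(c.+1 - r, c.+1 - b) + r).
  move=> fA' fB' xAB' dA' cond'.
  have b0 : 0 < b by lia.
  have fA1 := lex_family_link xS fA'; have fB0 := lex_family_deletion x fB'.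
  have [sB1 uB1 _] := lex_family_link xS fB'.
  have := leq_card_family sB1 uB1; rewrite cSx => lB1.
  have eA := card_link_deletion x A'; have eB := card_link_deletion x B'.
  rewrite dA' cards0 addn0 in eA.
  have pascal : 'C(a + c, b) = 'C(a.-1 + c, b) + 'C(a.-1 + c, b.-1).
    by rewrite -(prednK a0) -(prednK b0) addSn binS.
  have cond1 : size_condition a.-1 b c r #|link x A'| #|deletion x B'|.
    case: cond' => [[ab rA]|[ab [rA rB]]|[ab [rA rB]]].
    - by apply: Or31; lia.
    - by apply: Or31; lia.
    (* At most ['C(a.-1 + c, b.-1)] members of [B'] contain [x], so by Pascal's rule the lower bound
       on [#|B'|] passes to the deletion. *)
    have [e|lt] : a.-1 = b \/ b < a.-1 by lia.
      by have e2 : c + b = a.-1 + c; [lia | rewrite e2 in rB; apply: Or32; lia].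
    by apply: Or33; lia.
  have := IHm _ _ _ _ _ _ _ Sxm cSx rb bc fA1 fB0
    (cross_link_deletion xAB') cond1.
  by lia.
have [dA|dA] := eqVneq (deletion x A) set0; first exact: step.
have [b0 abS] : 0 < b /\ a + b <= #|S| by lia.
have dB := deletion_empty xS xmin fA fB xAB b0 abS dA.
case: (cond) => [[ab rA]|[ab [rA rB]]|[ab [rA rB]]]; last 1 first.
(* For [b < a] this is contradictory: [B] lies entirely through [x] but omits such a set, so it is
   smaller than the size condition demands. *)
- have := ltn_card_link xS fA fB xAB b0 abS dA.
  have := card_link_deletion x B; rewrite dB cards0 addn0 => <-.
  have : 'C(c + b, b) <= 'C(a.-1 + c, b) by apply: leq_bin2l; lia.
  have : 'C(a + c, b) = 'C(a.-1 + c, b) + 'C(a.-1 + c, b.-1).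
    by rewrite -(prednK a0) -(prednK b0) addSn binS.
  by rewrite cS; have -> : (a + c).-1 = a.-1 + c; lia.
- have bb : 'C(a + c, b) = 'C((a + c).-1, b) + 'C((a + c).-1, b.-1).
    by rewrite -(prednK a0) -(prednK b0) addSn binS.
  have fA0 := lex_family_deletion x fA; have fB1 := lex_family_link xS fB.
  have [sA1 uA1 _] := lex_family_link xS fA.
  have := leq_card_family sA1 uA1; have := bin_step a0 ab bc rb.
  have -> : #|S :\ x| = (a + c).-1 by lia.
  (* When [a = b - 1], the new condition asks for [r - K] members in both families; here
     [r <= a <= K], so this is 0. *)
  have Ka : a = b.-1 -> r <= 'C((a + c).-1, a.-1).
    move=> e; apply: (@leq_trans 'C(a, a.-1)); last by apply: leq_bin2l; lia.
    by rewrite -{1}(prednK a0) binSn; lia.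
  have cS1 : #|S :\ x| = a + c.-1 by lia.
  have := card_link_deletion x A; have := card_link_deletion x B.
  rewrite dB cards0 addn0 => eB eA.
  set K := 'C(_, a.-1) in Ka * => step_ineq lA.
  have cond1 : size_condition a b.-1 c.-1 (r - K) #|deletion x A| #|link x B|.
    have [e|lt] : a = b.-1 \/ a < b.-1 by lia.
      by apply: Or32; have := Ka e; lia.
    by apply: Or31; lia.
  have rK : r - K < b.-1.
    have : 0 < K by rewrite bin_gt0; lia.
    by lia.
  have bc1 : b.-1 <= c.-1 by lia.
  have := IHm _ _ _ _ _ _ _ Sxm cS1 rK bc1 fA0 fB1
    (cross_sym (cross_link_deletion (cross_sym xAB))) cond1.
  rewrite (prednK (_ : 0 < c)); last by lia.
  have -> : c - b.-1 = c.+1 - b by lia.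
  have -> : a + c.-1 = (a + c).-1 by lia.
  by lia.
- rewrite [#|A| + _]addnC; move: step; rewrite ab in fA cond *; apply=> //.
    exact: cross_sym.
  by apply: Or32; split; last by [].
Qed.

Theorem theorem6p3 (n a b r : nat) (A B : {set {set 'I_n}}) :
  0 < a -> 0 < b -> 0 < r -> a + b <= n ->
  uniform a A -> uniform b B -> cross_intersecting A B ->
  [\/ (a < b /\ r <= #|A|),
      (a = b /\ r <= #|A| /\ r <= #|B|)
    | (b < a /\ r <= #|A| /\ 'C(n, b) + r <= #|B| + 'C(n - a + b, b))] ->
  (1 <= r <= b - 1 ->
     #|A| + #|B| + 'C(n - a + 1, b) <= 'C(n, b) + 'C(n - a - r + 1, b - r) + r) /\
  (b <= r <= n - a + 1 ->
     #|A| + #|B| + 'C(n - a + 1, b) <= 'C(n, b) + (n - a + 1)).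
Proof.
move=> a0 b0 r0 abn uA uB xAB cond.
have [A' [B' [[uA' uB'] xAB' [cA cB] lA lB]]] := lex_reduction uA uB xAB.
have bc : b <= n - a by lia.
have en : a + (n - a) = n by lia.
have family k F : uniform k F -> lex_closed F -> lex_family [set: 'I_n] k F.
  by move=> uF lF; split=> // Z W ZF _; apply: lF.
(* The size condition is monotone in [r], so any smaller [s] may be used. *)
have bound s : s <= r -> s < b -> #|A| + #|B| + 'C((n - a).+1, b) <=
    'C(n, b) + ('C((n - a).+1 - s, (n - a).+1 - b) + s).
  move=> sr sb; rewrite -cA -cB -[X in 'C(X, b) + _]en.
  apply: (lex_bound _ sb bc (family _ _ uA' lA) (family _ _ uB' lB) xAB').
    by rewrite cardsT card_ord en.
  rewrite /size_condition en cA cB.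
  by case: cond => [[ab rA]|[ab [rA rB]]|[ab [rA rB]]];
    [apply: Or31 | apply: Or32 | apply: Or33]; lia.
rewrite addn1; split=> [/andP[_ rb]|/andP[br _]].
  have lt : r < b by lia.
  have := bound r (leqnn r) lt.
  have -> : n - a - r + 1 = (n - a).+1 - r by lia.
  rewrite -(@bin_sub _ (b - r)); last by lia.
  have -> : (n - a).+1 - r - (b - r) = (n - a).+1 - b by lia.
  by rewrite addnA.
(* At [s = b - 1] the last bracket equals [(n - a + 2 - b) + (b - 1) = n - a + 1]. *)
have := bound b.-1; have -> : (n - a).+1 - b.-1 = ((n - a).+1 - b).+1 by lia.
by rewrite binSn; lia.
Qed.
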